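(* Let $G$ be a connected graph with $n$ vertices, minimum degree at least $k$ and domination number $\gamma=\gamma(G)$. Then $\gamma_c(G)\le\gamma+f_{n,k}(\gamma)$. Consequently $$\gamma_c(G)<\gamma+\frac{n}{k+1}\big(\ln\lceil\ln(k+1)\rceil+3\big).$$
   Context: $\gamma(G)$ is the minimum size of a dominating set of $G$ (a set $X$ of vertices such that every vertex outside $X$ has a neighbor in $X$), and $\gamma_c(G)$ is the minimum size of a dominating set whose induced subgraph is connected. The function $f=f_{n,k}:[1,\infty)\to[0,\infty)$ is defined as follows: for real $x\ge1$ write $x=(y+z)\frac{n}{k+1}$ with $y\ge0$ an integer and $z\in[0,1]$ real; if $y=0$ then $f(x)=\frac{n}{k+1}2z-2$; if $y=1$ then $f(x)=\frac{n}{k+1}(\frac{z}{y}+2)-2$; if $y\ge2$ then $f(x)=\frac{n}{k+1}\big(\frac{z}{y}+\frac{1}{y-1}+\cdots+\frac11+2\big)-2$ (these definitions agree when $x$ has two such representations). *)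

(* Defs.v *)
From mathcomp Require Export all_boot all_order all_algebra.
From mathcomp Require Export boolp reals exp.

Set Implicit Arguments.
Unset Strict Implicit.
Unset Printing Implicit Defensive.

Import Order.TTheory GRing.Theory Num.Theory.

(* A finite simple graph is a finType of vertices together with a symmetric
   irreflexive adjacency relation. *)
Section Graph.
Variables (V : finType) (e : rel V).
Implicit Types X : {set V}.

Definition degree (v : V) : nat := #|[set w | e v w]|.

Definition induced X : rel V := [rel x y | [&& x \in X, y \in X & e x y]].

(* The graph without vertices is not counted as connected. *)
Definition connected_in X : bool :=
  (X != set0) && [forall x in X, forall y in X, connect (induced X) x y].

Definition connected_graph : bool := connected_in [set: V].

Definition dominating X : bool :=
  [forall v, (v \notin X) ==> [exists x in X, e v x]].

Definition connected_dominating X : bool := dominating X && connected_in X.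

Definition domination_number : nat :=
  #|[arg min_(X < [set: V] | dominating X) #|X| ]|.

(* Meaningful for connected graphs, where [set: V] is a candidate. *)
Definition connected_domination_number : nat :=
  #|[arg min_(X < [set: V] | connected_dominating X) #|X| ]|.

Lemma dominating_setT : dominating [set: V].
Proof. by apply/forallP => v; rewrite in_setT. Qed.

Lemma domination_numberP :
  (exists2 X, dominating X & #|X| = domination_number) /\
  (forall X, dominating X -> domination_number <= #|X|).
Proof.
rewrite /domination_number; case: arg_minnP => [|X dX minX].
  exact: dominating_setT.
by split=> //; exists X.
Qed.

Lemma connected_domination_numberP : connected_graph ->
  (exists2 X, connected_dominating X & #|X| = connected_domination_number) /\
  (forall X, connected_dominating X -> connected_domination_number <= #|X|).
Proof.
move=> cG; rewrite /connected_domination_number.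
case: arg_minnP => [|X dX minX].
  by rewrite /connected_dominating dominating_setT.
by split=> //; exists X.
Qed.

End Graph.

Local Open Scope ring_scope.

Section Bound.
Variable R : realType.

Definition f_piece (n k y : nat) (z : R) : R :=
  let c := n%:R / k.+1%:R in
  match y with
  | 0%N => c * (2 * z) - 2
  | 1%N => c * (z / y%:R + 2) - 2
  | _ => c * (z / y%:R + \sum_(1 <= i < y) i%:R^-1 + 2) - 2
  end.

(* Among the representations x = (y + z) n/(k+1), the one with 0 <= z < 1 is
   selected; by [fnkE] any other one gives the same value. *)
Definition fnk (n k : nat) (x : R) : R :=
  let t := x / (n%:R / k.+1%:R) in
  let y := Num.truncn t in
  f_piece n k y (t - y%:R).

Lemma f_piece1 (n k y : nat) : f_piece n k y 1 = f_piece n k y.+1 0.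
Proof.
case: y => [|[|y]] /=.
- by rewrite mul0r add0r mulr1.
- by rewrite big_nat1 mul0r add0r div1r.
- by rewrite mul0r add0r div1r [in RHS]big_nat_recr //= [in RHS](addrC _ y.+2%:R^-1).
Qed.

Lemma fnkE (n k y : nat) (z : R) : (0 < n)%N -> 0 <= z <= 1 ->
  fnk n k ((y%:R + z) * (n%:R / k.+1%:R)) = f_piece n k y z.
Proof.
move=> n0 /andP[z0]; rewrite /fnk mulfK; last first.
  by rewrite mulf_neq0 ?invr_eq0 ?pnatr_eq0 -?lt0n.
rewrite le_eqVlt => /predU1P[->|z1].
  by rewrite natr1 natrK subrr f_piece1.
have /eqP -> : Num.truncn (y%:R + z) == y.
  by rewrite truncn_eq ?addr_ge0// lerDl z0 -natr1 ltrD2l.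
by rewrite addrAC subrr add0r.
Qed.

End Bound.

(* Main.v *)
(* Write c = n/(k+1). Start from a minimum dominating set X, with T = X meeting
   every component of G[X]. By double counting, some closed neighbourhood N[v]
   contains at least |T|/c elements of T; adding v to X merges their components.
   If yc < |T| <= (y+1)c with y >= 1, one new vertex thus lowers |T| by y or
   more, and if |T| <= c, two new vertices on a shortest path between two
   components lower it by one. As f is concave with slopes 2, 1, 1/2, 1/3, ...
   on the successive intervals of length c, f(|T|) pays for all these additions.

   The second bound follows from gamma <= c (1 + ln(k+1)), which comes from
   greedy domination using the same double counting, and from
   f((l+1)c) = c (1 + 1/2 + ... + 1/l + 2) - 2. *)
Require Import Defs.
From mathcomp Require Import ring lra.

Set Implicit Arguments.
Unset Strict Implicit.
Unset Printing Implicit Defensive.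

Import Order.TTheory GRing.Theory Num.Theory.
Local Open Scope ring_scope.

(** * Slopes, concavity and logarithmic growth of [fnk] *)

Section Bound.
Variables (R : realType) (n k : nat).
Hypothesis n_gt0 : (0 < n)%N.
Let c : R := n%:R / k.+1%:R.

Let c_gt0 : 0 < c. Proof. by rewrite divr_gt0 ?ltr0n. Qed.

(** The derivative of [fnk] in its argument between y c and (y+1) c; in the rescaled variable of
    [f_piece] it carries an extra factor [c]. *)
Definition slope (y : nat) : R := if y is 0 then 2 else y%:R^-1.

Lemma slope_ge0 y : 0 <= slope y.
Proof. by case: y => [|y] /=; rewrite ?invr_ge0 ler0n. Qed.

Lemma slopeS y : slope y.+1 <= slope y.
Proof.
case: y => [|y] /=; first by rewrite invr1 ler1n.
by rewrite lef_pV2 ?posrE ?ltr0n// ler_nat.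
Qed.

Lemma f_pieceE y (z : R) : f_piece n k y z = c * slope y * z + f_piece n k y 0.
Proof.
case: y => [|[|y]]; rewrite /f_piece /slope -/c; first by ring.
  by rewrite invr1; ring.
move: (\sum_(_ <= _ < _) _) => s; ring.
Qed.

(** Consecutive affine pieces agree at the breakpoint t = y+1, so they differ by the change of slope
    times the distance to it. *)
Lemma f_pieceS y (t : R) :
  f_piece n k y.+1 (t - y.+1%:R) =
  f_piece n k y (t - y%:R) + c * (slope y.+1 - slope y) * (t - y.+1%:R).
Proof.
rewrite f_pieceE -f_piece1 (f_pieceE y 1) (f_pieceE y (t - _)) -natr1.
ring.
Qed.

(* [fnk] is concave: it is the lower envelope of the affine extensions of its
   pieces. *)
Lemma fnk_le_piece y (x : R) : 0 <= x ->
  fnk n k x <= f_piece n k y (x / c - y%:R).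
Proof.
move=> x0; rewrite /fnk -/c; set t := x / c.
have t0 : 0 <= t by rewrite divr_ge0 // ltW.
have /andP[] := truncn_itv t0; set y0 := Num.truncn t => y0t ty0.
have D i : c * (slope i.+1 - slope i) <= 0.
  by rewrite pmulr_rle0 // subr_le0 slopeS.
(* Going from the active piece [y0] to [y] one index at a time, each step upwards passes a
   breakpoint right of [t] and each step downwards one at or left of [t]. By [f_pieceS] and [D]
   neither lowers the value. *)
have [le_y0|lt_y] := leqP y0 y.
  rewrite -(subnK le_y0); elim: (y - y0)%N => [|i IH] //.
  rewrite addSn f_pieceS; apply: (le_trans IH); rewrite lerDl.
  apply: mulr_le0 => //; rewrite subr_le0; apply: le_trans (ltW ty0) _.
  by rewrite ler_nat ltnS leq_addl.
have : y0%:R <= t by [].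
rewrite -(subnK (ltnW lt_y)); elim: (y0 - y)%N => [|i IH] // le_t.
rewrite addSn f_pieceS; rewrite addSn in le_t; apply: le_trans (IH _).
  rewrite gerDl; apply: mulr_le0_ge0 => //.
  by rewrite subr_ge0.
by apply: le_trans le_t; rewrite ler_nat.
Qed.

(** The line extending the piece at [b] bounds [fnk] at [a] from above. For a <= b this measures how
    much budget is released when the argument drops from [b] to [a]. *)
Lemma fnk_slope y (a b : R) : 0 <= a -> y%:R * c <= b <= y.+1%:R * c ->
  fnk n k a + slope y * (b - a) <= fnk n k b.
Proof.
move=> a0 /andP[yb by1].
(* [fnkE] also covers the right end, where [fnk] itself selects piece y+1. *)
have -> : fnk n k b = f_piece n k y (b / c - y%:R).
  rewrite -fnkE //; last first.
    by rewrite subr_ge0 lerBlDl natr1 ler_pdivlMr // ler_pdivrMr // yb.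
  by rewrite addrC subrK -/c divfK // gt_eqF.
have := fnk_le_piece y a0; rewrite f_pieceE [in X in _ -> X]f_pieceE.
have -> : slope y * (b - a) = c * slope y * (b / c - y%:R) -
   c * slope y * (a / c - y%:R).
  by field; rewrite gt_eqF.
lra.
Qed.

Lemma fnk_mono (a b : R) : 0 <= a <= b -> fnk n k a <= fnk n k b.
Proof.
move=> /andP[a0 ab].
have t0 : 0 <= b / c by rewrite divr_ge0 ?(le_trans a0 ab) ?ltW.
have /andP[y0 y1] := truncn_itv t0.
have : fnk n k a + slope (Num.truncn (b / c)) * (b - a) <= fnk n k b.
  by apply: fnk_slope; rewrite // -ler_pdivlMr // y0 -ler_pdivrMr // ltW.
by apply: le_trans; rewrite lerDl mulr_ge0 ?slope_ge0 ?subr_ge0.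
Qed.

Lemma ln_le_subr1 (x : R) : 0 < x -> ln x <= x - 1.
Proof. by move=> x0; rewrite -{1}(addrNK 1 x) addrC le_ln1Dx // ltrBrDl subrr. Qed.

(** Telescoping: 1/(m+2) <= ln (m+2) - ln (m+1), because ln (1 - 1/(m+2)) <= -1/(m+2). *)
Lemma harmonic_le_ln m : (0 < m)%N ->
  \sum_(1 <= i < m.+1) i%:R^-1 <= 1 + ln m%:R :> R.
Proof.
elim: m => // [[_ _|m /(_ isT) IH _]]; first by rewrite big_nat1 ln1 invr1 addr0.
rewrite big_nat_recr //=; move: IH; set S := (\sum_(_ <= _ < _) _) => IH.
suff D : m.+2%:R^-1 <= ln m.+2%:R - ln m.+1%:R :> R.
  by apply: le_trans (lerD IH D) _; rewrite [ln m.+2%:R - _]addrC addrA addrK.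
rewrite -ln_div ?posrE ?ltr0n //.
have : ln (1 + (- m.+2%:R^-1)) <= - m.+2%:R^-1 :> R.
  by apply: le_ln1Dx; rewrite ltrN2 invf_lt1 ?ltr0n // ltr1n.
have -> : 1 + (- m.+2%:R^-1) = (m.+2%:R / m.+1%:R)^-1 :> R.
  rewrite -(natr1 m.+1); have : 0 < m.+1%:R :> R by [].
  by move: (m.+1%:R) => a a0; field; rewrite !gt_eqF //; lra.
by rewrite lnV ?posrE ?divr_gt0 ?ltr0n // lerN2.
Qed.

(** By monotonicity only x = (l+1) c matters; the term -2 in the value there makes the inequality
    strict. *)
Lemma fnk_lt_ln (x : R) (l : nat) : (0 < l)%N -> 0 <= x <= l.+1%:R * c ->
  fnk n k x < c * (ln l%:R + 3).
Proof.
move=> l0 /fnk_mono /le_lt_trans; apply.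
have -> : l.+1%:R * c = (l%:R + 1) * c by rewrite natr1.
rewrite fnkE ?lexx ?ler01 //.
have -> : f_piece n k l 1 = c * (\sum_(1 <= i < l.+1) i%:R^-1 + 2) - 2 :> R.
  case: l l0 => [|[|l]] // _; rewrite /f_piece -/c.
    by rewrite big_nat1 mul1r.
  by rewrite [in RHS]big_nat_recr //= div1r; ring.
have := harmonic_le_ln l0; rewrite -(ler_pM2l c_gt0).
lra.
Qed.

End Bound.

(** * Closed neighbourhoods and the merging of components *)

Section Neighbourhoods.
Local Open Scope nat_scope.
Variables (V : finType) (e : rel V).
Hypothesis e_sym : symmetric e.
Implicit Types (X Y T S : {set V}) (v w : V).

Definition cnbhd v : {set V} := [set w | (w == v) || e v w].

Lemma cnbhd_sym v w : (w \in cnbhd v) = (v \in cnbhd w).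
Proof. by rewrite !inE eq_sym e_sym. Qed.

Lemma card_cnbhd v : irreflexive e -> #|cnbhd v| = (degree e v).+1.
Proof.
move=> e_irr; have -> : cnbhd v = v |: [set w | e v w].
  by apply/setP=> w; rewrite !inE.
by rewrite cardsU1 inE e_irr.
Qed.

(** Count the pairs (w, u) with u in both [S] and N[w]: by symmetry each u in [S] occurs in #|N[u]|
    > k of them. A vertex with maximal intersection reaches the average. *)
Lemma cnbhd_averaging k S : 0 < #|V| -> (forall v, k < #|cnbhd v|) ->
  exists v, #|S| * k.+1 <= #|cnbhd v :&: S| * #|V|.
Proof.
move=> /card_gt0P[v0 _] kP.
case: (@arg_maxnP _ v0 predT (fun v => #|cnbhd v :&: S|) isT) => v _ vmax.
exists v; rewrite mulnC -[_ * #|V|]mulnC -sum_nat_const.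
apply: (@leq_trans (\sum_w #|cnbhd w :&: S|)); last first.
  by apply: leq_sum => w _; apply: vmax.
have -> : \sum_w #|cnbhd w :&: S| = \sum_(w in S) #|cnbhd w|.
  under eq_bigr do rewrite -sum1_card.
  rewrite (exchange_big_dep (mem S)) /=; last by move=> w u _; rewrite inE => /andP[].
  apply: eq_bigr => u uS; rewrite -sum1_card; apply: eq_bigl => w.
  by rewrite inE uS andbT cnbhd_sym.
by rewrite mulnC -sum_nat_const; apply: leq_sum.
Qed.

Lemma dominatingP X :
  reflect (forall v, exists2 x, x \in X & x \in cnbhd v) (dominating e X).
Proof.
apply: (iffP forallP) => dX v.
  have := dX v; have [vX _|_ /existsP[x /andP[xX evx]]] := boolP (v \in X).
    by exists v; rewrite // inE eqxx.
  by exists x; rewrite // inE evx orbT.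
apply/implyP => vX; have [x xX] := dX v; rewrite inE.
case/predU1P => [xv|evx]; first by rewrite -xv xX in vX.
by apply/existsP; exists x; rewrite xX.
Qed.

Lemma dominatingS X Y : X \subset Y -> dominating e X -> dominating e Y.
Proof.
move=> /subsetP XY /dominatingP dX; apply/dominatingP => v.
by have [x /XY] := dX v; exists x.
Qed.

Lemma connect_induced_sym X : connect_sym (induced e X).
Proof.
by apply: sym_connect_sym => x y; rewrite /induced /= e_sym andbCA.
Qed.

Lemma connect_inducedS X Y x y : X \subset Y ->
  connect (induced e X) x y -> connect (induced e Y) x y.
Proof.
move=> /subsetP XY; apply: connect_sub => {}x {}y /= /and3P[/XY xY /XY yY exy].
by apply: connect1; rewrite /induced /= xY yY.
Qed.

Lemma connect_cnbhd X x y : x \in X -> y \in X -> y \in cnbhd x ->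
  connect (induced e X) x y.
Proof.
move=> xX yX; rewrite inE => /predU1P[->|exy]; first exact: connect0.
by apply: connect1; rewrite /induced /= xX yX.
Qed.

(* [T] meets every connected component of the graph induced on [X]; it plays
   the role of the set of components, with repetitions allowed. *)
Definition rooted X T :=
  T \subset X /\ forall x, x \in X -> exists2 t, t \in T & connect (induced e X) x t.

Lemma rooted_refl X : rooted X X.
Proof. by split=> // x xX; exists x. Qed.

(** Once [v] is added, it is joined to every root in N[v] and can replace them all. *)
Lemma rooted_star X T v (T' := v |: T :\: cnbhd v) : rooted X T ->
  rooted (v |: X) T' /\ #|T'| + #|cnbhd v :&: T| <= #|T|.+1.
Proof.
move=> [TX rX]; have sX : X \subset v |: X by rewrite subsetUr.
split; last first.
  rewrite cardsU1 -addnA setIC addnC [#|_ :\: _| + _]addnC cardsID addnC.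
  by case: (_ \notin _).
split.
  by apply: setUS; apply: subset_trans (subsetDl _ _) TX.
move=> x /setU1P[->|/rX[t tT /(connect_inducedS sX) xt]].
  by exists v; rewrite // setU11.
have [tv|tv] := boolP (t \in cnbhd v).
  exists v; first by rewrite setU11.
  apply: connect_trans xt _; apply: connect_cnbhd; rewrite ?setU11 //.
    by rewrite (subsetP sX) // (subsetP TX).
  by rewrite cnbhd_sym.
by exists t; rewrite // in_setU1 inE tv tT orbT.
Qed.

(* Two components of a dominating set at minimal distance are at distance at
   most 3. *)
Lemma rooted_bridge X T : connected_graph e -> dominating e X -> rooted X T ->
    X != set0 -> ~~ connected_in e X ->
  exists X' T', [/\ X \subset X', #|X'| <= #|X|.+2, rooted X' T',
    0 < #|T'| & #|T'| < #|T|].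
Proof.
move=> /andP[_ Gc] /dominatingP dX [TX rX] X0; rewrite /connected_in X0 /=.
case/forall_inPn => x xX /forall_inPn[y yX xy].
(* [A] is the component of [x] in G[X] and [W] its closed neighbourhood, which meets [X] only in
   [A]. Since [y] is outside [W] and G is connected, some edge a b leaves [W]. *)
pose A := [set z in X | connect (induced e X) x z].
pose W := [set w | [exists a in A, w \in cnbhd a]].
have AW z a : a \in A -> z \in cnbhd a -> z \in W.
  by move=> aA za; rewrite inE; apply/exists_inP; exists a.
have AP z : z \in X -> z \in W -> z \in A.
  rewrite inE => zX /exists_inP[a]; rewrite inE => /andP[aX xa] za.
  by rewrite inE zX; apply: connect_trans xa (connect_cnbhd aX zX za).
have xA : x \in A by rewrite inE xX connect0.
have yW : y \notin W.
  by apply: contra xy => /(AP _ yX); rewrite inE => /andP[].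
have [a [b [aW bW eab]]] : exists a b, [/\ a \in W, b \notin W & e a b].
  case: (boolP [exists a in W, exists b, (b \notin W) && e a b]).
    by case/exists_inP => a aW /existsP[b /andP[bW eab]]; exists a, b.
  move=> noedge; case/negP: yW.
  have cl : closed (induced e [set: V]) W.
    apply: intro_closed; first exact: connect_induced_sym.
    move=> a b /and3P[_ _ eab] aW; apply: contraR noedge => bW.
    by apply/exists_inP; exists a => //; apply/existsP; exists b; rewrite bW.
  have /forall_inP/(_ x (in_setT _))/forall_inP/(_ y (in_setT _)) cxy := Gc.
  by rewrite -(closed_connect cl cxy); apply: AW xA _; rewrite inE eqxx.
have [a0 a0A aa0] : exists2 a0, a0 \in A & a \in cnbhd a0.
  by move: aW; rewrite inE => /exists_inP[a0]; exists a0.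
have [z zX zb] := dX b.
have zA : z \notin A.
  by apply: contra bW => zA; apply: AW zA _; rewrite cnbhd_sym.
have [[t0 t0T xt0] [t1 t1T zt1]] := (rX x xX, rX z zX).
have t01 : t0 != t1.
  apply: contra zA => /eqP t01; rewrite inE zX (connect_trans xt0) //.
  by rewrite connect_induced_sym t01.
pose X' := a |: (b |: X); exists X', (T :\ t1).
have sX : X \subset X' by rewrite !subsetU ?subxx ?orbT.
have XX' := subsetP sX; have cX := connect_inducedS sX.
have [aX' bX'] : a \in X' /\ b \in X' by rewrite !inE !eqxx ?orbT.
have a0X : a0 \in X by move: a0A; rewrite inE => /andP[].
have at0 : connect (induced e X') a t0.
  apply: connect_trans (cX _ _ xt0); rewrite connect_induced_sym.
  apply: connect_trans (connect_cnbhd (XX' _ a0X) aX' aa0).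
  by apply: cX; move: a0A; rewrite inE => /andP[].
have bt0 : connect (induced e X') b t0.
  apply: connect_trans at0; apply: connect_cnbhd => //.
  by rewrite inE e_sym eab orbT.
have t0T' : t0 \in T :\ t1 by rewrite !inE t01.
split=> //.
- rewrite /X' (leq_trans (leq_card_setU _ _).1) // cards1 add1n ltnS.
  by rewrite (leq_trans (leq_card_setU _ _).1) // cards1 add1n.
- split; first by rewrite (subset_trans (subsetDl _ _)) // (subset_trans TX).
  move=> u /setU1P[->|/setU1P[->|uX]]; try by exists t0.
  have [t tT ut] := rX u uX; have [tt1|tt1] := eqVneq t t1; last first.
    by exists t; [rewrite !inE tt1 | apply: cX].
  exists t0 => //; apply: connect_trans bt0.
  apply: connect_trans (cX _ _ ut) _; rewrite tt1 connect_induced_sym.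
  apply: connect_trans (connect_cnbhd bX' (XX' _ zX) zb) (cX _ _ zt1).
- by apply/card_gt0P; exists t0.
- by rewrite (cardsD1 t1 T) t1T.
Qed.
End Neighbourhoods.

(** * Connecting a dominating set, and greedy domination, under a minimum degree *)

Section MinimumDegree.
Variables (R : realType) (V : finType) (e : rel V) (k : nat).
Hypotheses (e_sym : symmetric e) (e_irr : irreflexive e).
Hypothesis e_conn : connected_graph e.
Hypothesis e_mindeg : forall v : V, (k <= degree e v)%N.
Implicit Types (X T S D : {set V}).
Local Notation n := #|V|.
Let c : R := n%:R / k.+1%:R.

Lemma card_cnbhd_gt v : (k < #|cnbhd e v|)%N.
Proof. by rewrite card_cnbhd // ltnS e_mindeg. Qed.

Lemma card_graph_gt0 : (0 < n)%N.
Proof. by rewrite -cardsT card_gt0; case/andP: e_conn. Qed.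

Lemma ratio_ge1 : 1 <= c.
Proof.
have /card_gt0P[v _] := card_graph_gt0.
rewrite ler_pdivlMr ?ltr0n // mul1r ler_nat.
by apply: leq_trans (card_cnbhd_gt v) (max_card _).
Qed.

Let c_gt0 : 0 < c. Proof. exact: lt_le_trans ltr01 ratio_ge1. Qed.

(** Since c >= 1, the point 1 lies on the first piece, with z = 1/c. *)
Lemma fnk1 : fnk n k (1 : R) = 0.
Proof.
have -> : 1 = (0%:R + c^-1) * c :> R by rewrite add0r mulVf // gt_eqF.
rewrite fnkE ?card_graph_gt0 // -/c; last first.
  by rewrite invr_ge0 ltW //= invf_le1 // ratio_ge1.
by rewrite /f_piece -/c mulrCA divff ?gt_eqF // mulr1 subrr.
Qed.

(** Induction on #|T| with [fnk] at #|T| as the budget: each round lowers the budget by at least the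
    number of vertices it adds. *)
Lemma connect_rooted X T : dominating e X -> rooted e X T -> (0 < #|T|)%N ->
  exists2 Y, connected_dominating e Y
    & #|Y|%:R <= #|X|%:R + fnk n k #|T|%:R :> R.
Proof.
move: {2}_.+1 (ltnSn #|T|) => m; elim: m X T => // m IH X T ltT dX rX T_gt0.
have n0 := card_graph_gt0.
have [cX|ncX] := boolP (connected_in e X).
  exists X; first exact/andP.
  by rewrite lerDl -fnk1 fnk_mono // ler01 ler1n.
have X0 : X != set0.
  apply: contraTneq T_gt0 => X0; have [+ _] := rX.
  by rewrite X0 subset0 => /eqP->; rewrite cards0.
(* The predecessor gives y c < #|T| <= (y+1) c with the strict inequality on the left, so that
   averaging later finds at least y+1 roots in one N[v]. *)
pose y := ((#|T| * k.+1).-1 %/ n)%N.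
have p0 : (0 < #|T| * k.+1)%N by rewrite muln_gt0 T_gt0.
have yT : (y * n < #|T| * k.+1)%N.
  by rewrite -(prednK p0) ltnS leq_trunc_div.
have Ty : (#|T| * k.+1 <= y.+1 * n)%N.
  by rewrite -[X in (X <= _)%N](prednK p0) ltn_ceil.
have slopeT (i : nat) : fnk n k (i%:R : R) + slope R y * (#|T|%:R - i%:R)
    <= fnk n k #|T|%:R.
  apply: fnk_slope => //; rewrite !mulrA.
  by rewrite ler_pdivrMr ?ler_pdivlMr ?ltr0n // -!natrM !ler_nat Ty ltnW.
(* Here the slope is 2: losing one root pays for the two bridging vertices. *)
have [y0|y_gt0] := posnP y.
  have [X' [T' [sX cX' rX' T'0 ltT']]] :=
    rooted_bridge e_sym e_conn dX rX X0 ncX.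
  have [|Y dY cY] := IH X' T' _ (dominatingS sX dX) rX' T'0.
    by rewrite -ltnS (leq_trans _ ltT).
  exists Y => //; apply: le_trans cY _; have := slopeT #|T'|; rewrite y0 /=.
  move: cX' ltT'; rewrite -!(ler_nat R) -!natr1; lra.
(* Adding [v] removes at least y roots, each worth 1/y, which pays for [v]. *)
have [v vT] := cnbhd_averaging e_sym T n0 card_cnbhd_gt.
have yv : (y < #|cnbhd e v :&: T|)%N.
  by rewrite -(ltn_pmul2r n0) (leq_trans yT).
have [] := rooted_star e_sym v rX; set T' := _ |: (_ :\: _) => rX' cT'.
have T'T : (#|T'| + y <= #|T|)%N.
  by rewrite -ltnS -addnS; apply: leq_trans cT'; rewrite leq_add2l.
have [||Y dY cY] := IH (v |: X) T' _ (dominatingS (subsetUr _ _) dX) rX'.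
- rewrite -ltnS; apply: leq_trans ltT; rewrite ltnS; apply: leq_trans T'T.
  by rewrite -addn1 leq_add2l.
- by apply/card_gt0P; exists v; rewrite setU11.
exists Y => //; apply: le_trans cY _.
have : (#|v |: X| <= #|X|.+1)%N.
  by rewrite (leq_trans (leq_card_setU _ _).1) // cards1.
rewrite -(ler_nat R) -natr1; have := slopeT #|T'|.
have : 1 <= slope R y * (#|T|%:R - #|T'|%:R).
  rewrite (_ : slope R y = y%:R^-1); last by case: (y) y_gt0.
  by rewrite mulrC ler_pdivlMr ?ltr0n // mul1r lerBrDl -natrD ler_nat.
lra.
Qed.

(** Choose [v] covering at least #|S|/c vertices of [S] and recurse while at least [c] remain
    uncovered; after that, take the remaining vertices themselves. *)
Lemma domination_greedy S : c <= #|S|%:R ->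
  exists2 D : {set V}, (forall v, v \in S -> exists2 x, x \in D & x \in cnbhd e v)
    & #|D|%:R <= c * (1 + ln (#|S|%:R / c)).
Proof.
move: {2}_.+1 (ltnSn #|S|) => m; elim: m S => // m IH S ltS cS.
have u0 : 0 < #|S|%:R :> R by apply: lt_le_trans cS.
have [v vS] := cnbhd_averaging e_sym S card_graph_gt0 card_cnbhd_gt.
pose S' := S :\: cnbhd e v; pose q := c / #|S|%:R.
have cardS : #|S|%:R = #|cnbhd e v :&: S|%:R + #|S'|%:R :> R.
  by rewrite -natrD setIC cardsID.
have q0 : 0 < q by rewrite divr_gt0.
have q1 : q <= 1 by rewrite ler_pdivrMr // mul1r.
have uq : #|S|%:R * q = c by rewrite mulrC divfK // gt_eqF.
have dq : 1 <= (#|S|%:R - #|S'|%:R) * q.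
  rewrite cardS addrK mulrA ler_pdivlMr // mul1r mulrA ler_pdivlMr ?ltr0n //.
  by rewrite -!natrM ler_nat.
have ltS' : (#|S'| < #|S|)%N.
  rewrite -(ltr_nat R) -subr_gt0 -(pmulr_lgt0 _ q0).
  exact: lt_le_trans ltr01 dq.
have domS D : (forall w, w \in S' -> exists2 x, x \in D & x \in cnbhd e w) ->
    forall w, w \in S -> exists2 x, x \in v |: D & x \in cnbhd e w.
  move=> DP w wS; have [wv|wv] := boolP (w \in cnbhd e v).
    by exists v; rewrite ?setU11 // cnbhd_sym.
  have [|x xD xw] := DP w; first by rewrite inE wv.
  by exists x; rewrite // in_setU1 xD orbT.
have cardU D : #|v |: D|%:R <= 1 + #|D|%:R :> R.
  by rewrite -(natrD R 1) ler_nat add1n (leq_trans (leq_card_setU _ _).1) // cards1.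
have [cS'|S'c] := leP c #|S'|%:R.
  have [|D /domS DP cD] := IH S' _ cS'; first by rewrite (leq_trans ltS').
  exists (v |: D) => //; apply: le_trans (cardU D) _.
  have w0 : 0 < #|S'|%:R :> R by apply: lt_le_trans cS'.
  (* From ln x <= x - 1 at x = #|S'|/#|S|: the logarithmic term drops by at least (#|S| - #|S'|) q
     >= 1, the cost of [v]. *)
  have w_u : c * ln (#|S'|%:R / c) <=
      c * ln (#|S|%:R / c) + (#|S'|%:R * q - c).
    rewrite -lerBlDl -mulrBr -ln_div ?posrE ?(divr_gt0 _ c_gt0) //.
    have -> : #|S'|%:R * q - c = c * (#|S'|%:R / #|S|%:R - 1).
      by rewrite mulrBr mulr1 mulrCA.
    have -> : #|S'|%:R / c / (#|S|%:R / c) = #|S'|%:R / #|S|%:R.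
      by move: c_gt0 u0; move: c => c' c0 u0; field; rewrite !gt_eqF.
    by rewrite ler_pM2l // ln_le_subr1 ?divr_gt0.
  move: cD dq w_u; rewrite mulrBl uq; lra.
(* With s = #|S'| < c: 1 + s <= c + s (1 - q) <= c + c (1 - q), and 1 - q <= -ln q = ln (#|S|/c). *)
exists (v |: S'); first by apply: domS => w wS'; exists w; rewrite // inE eqxx.
apply: le_trans (cardU _) _.
have : c * (1 - q) <= c * ln (#|S|%:R / c).
  rewrite ler_pM2l // -invf_div lnV ?posrE // -/q.
  by rewrite -[1 - q]opprB lerN2 ln_le_subr1.
have : 0 <= (c - #|S'|%:R) * (1 - q) by rewrite mulr_ge0 ?subr_ge0 // ltW.
move: dq; rewrite mulrBl uq; lra.
Qed.

Lemma domination_number_le_ln :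
  (domination_number e)%:R <= c * (1 + ln k.+1%:R).
Proof.
have n0 := card_graph_gt0.
have [|D DP] := @domination_greedy [set: V].
  rewrite cardsT ler_pdivrMr ?ltr0n // ler_peMr ?ler0n // ler1n //.
rewrite cardsT invf_div mulrCA divff ?pnatr_eq0 -?lt0n // mulr1.
apply: le_trans; rewrite ler_nat; have [_ minD] := domination_numberP e.
apply: minD; apply/(dominatingP e) => v; exact: DP.
Qed.

End MinimumDegree.

Theorem theorem7p3 (R : realType) (V : finType) (e : rel V) (k : nat)
    (e_sym : symmetric e) (e_irr : irreflexive e)
    (e_conn : connected_graph e)
    (e_mindeg : forall v : V, (k <= degree e v)%N) :
  let n := #|V| in
  let gamma := domination_number e in
  let gamma_c := connected_domination_number e in
  gamma_c%:R <= gamma%:R + fnk n k gamma%:R :> R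
  /\ ((0 < k)%N ->
      gamma_c%:R < gamma%:R
        + n%:R / k.+1%:R * (ln (Num.ceil (ln (k.+1%:R : R)))%:~R + 3) :> R).
Proof.
move=> n gamma gamma_c.
have n0 : (0 < n)%N by apply: (card_graph_gt0 e_conn).
have [[X dX cX] _] := domination_numberP e.
have [_ minY] := connected_domination_numberP e_conn.
have X0 : (0 < #|X|)%N.
  have /card_gt0P[v _] := n0; have /dominatingP/(_ v)[x xX _] := dX.
  by apply/card_gt0P; exists x.
have le_gamma : gamma_c%:R <= gamma%:R + fnk n k gamma%:R :> R.
  have [Y dY cY] :=
    connect_rooted R e_sym e_irr e_conn e_mindeg dX (rooted_refl e X) X0.
  rewrite -/n cX in cY; apply: le_trans cY.
  by rewrite ler_nat; apply: minY.
split=> // k0; apply: le_lt_trans le_gamma _; rewrite ltrD2l.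
have lnk : 0 < ln (k.+1%:R : R) by rewrite ln_gt0 // ltr1n.
have : 0 < Num.ceil (ln (k.+1%:R : R)) by rewrite ceil_gt0.
have := ceil_ge (ln (k.+1%:R : R)).
(* With [l] the ceiling of ln (k+1), positive since k > 0, the greedy bound gives gamma <= c (1 + ln
   (k+1)) <= (l+1) c. *)
case: (Num.ceil _) => // l le_l l0.
apply: fnk_lt_ln => //; rewrite ler0n /=.
apply: le_trans (domination_number_le_ln R e_sym e_irr e_conn e_mindeg) _.
by rewrite mulrC ler_wpM2r ?divr_ge0 ?ler0n // -[l.+1%:R]natr1 addrC lerD2r.
Qed.
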